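(* Let $p$ be an odd prime, let $\lambda, x, y\in\mathbb{C}_p$ with $\lambda\neq 0$, let $w_1,w_2\in\mathbb{N}$ with $w_1\equiv 1\pmod 2$ and $w_2\equiv 1\pmod 2$, and let $n\ge 0$ and $m\ge 1$ be integers. Then $$\sum_{k=0}^{n}\binom{n}{k}w_{1}^{k}w_{2}^{n-k}\,\mathcal{E}_{n-k}^{(m-1)}\left(w_{1}y\,\Big|\,\frac{\lambda}{w_{2}}\right)\sum_{i=0}^{w_{1}-1}(-1)^{i}\,\mathcal{E}_{k}^{(m)}\left(w_{2}x+\frac{w_{2}}{w_{1}}i\,\Big|\,\frac{\lambda}{w_{1}}\right)$$ $$=\sum_{k=0}^{n}\binom{n}{k}w_{2}^{k}w_{1}^{n-k}\,\mathcal{E}_{n-k}^{(m-1)}\left(w_{2}y\,\Big|\,\frac{\lambda}{w_{1}}\right)\sum_{i=0}^{w_{2}-1}(-1)^{i}\,\mathcal{E}_{k}^{(m)}\left(w_{1}x+\frac{w_{1}}{w_{2}}i\,\Big|\,\frac{\lambda}{w_{2}}\right).$$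
   Context: $\mathbb{N}=\{1,2,3,\dots\}$, and $\mathbb{C}_p$ is the completion of the algebraic closure of the field $\mathbb{Q}_p$ of $p$-adic numbers. For $n\ge 0$ put $(x\mid\lambda)_n = x(x-\lambda)(x-2\lambda)\cdots(x-(n-1)\lambda)$, with $(x\mid\lambda)_0=1$. As a formal power series in $t$, $(1+\lambda t)^{x/\lambda}=\sum_{n\ge 0}(x\mid\lambda)_n\frac{t^n}{n!}$. For an integer $r\ge 0$, the higher-order degenerate Euler polynomials $\mathcal{E}_n^{(r)}(x\mid\lambda)$ are defined by $$\left(\frac{2}{(1+\lambda t)^{1/\lambda}+1}\right)^{r}(1+\lambda t)^{x/\lambda}=\sum_{n=0}^{\infty}\mathcal{E}_n^{(r)}(x\mid\lambda)\frac{t^n}{n!}$$ (for $r=0$ the first factor is $1$, so $\mathcal{E}_n^{(0)}(x\mid\lambda)=(x\mid\lambda)_n$). *)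

(* Defs.v *)
From HB Require Import structures.
From mathcomp Require Import all_boot all_order all_algebra.
From mathcomp Require Import reals.

Set Implicit Arguments.
Unset Strict Implicit.
Unset Printing Implicit Defensive.

Import Order.TTheory GRing.Theory Num.Theory.
Local Open Scope ring_scope.

Section AbsoluteValue.
Variable R : realType.

Record nonarchimedean_abs (K : fieldType) (v : K -> R) : Prop := {
  nabs_ge0 : forall x, 0 <= v x;
  nabs_eq0 : forall x, v x = 0 <-> x = 0;
  nabsM : forall x y, v (x * y) = v x * v y;
  nabsD : forall x y, v (x + y) <= Num.max (v x) (v y)
}.

Definition abs_cauchy (K : fieldType) (v : K -> R) (u : nat -> K) : Prop :=
  forall e : R, 0 < e -> exists N : nat, forall i j : nat,
    (N <= i)%N -> (N <= j)%N -> v (u i - u j) < e.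

Definition abs_cvg_to (K : fieldType) (v : K -> R) (u : nat -> K) (l : K) :
    Prop :=
  forall e : R, 0 < e -> exists N : nat, forall i : nat,
    (N <= i)%N -> v (u i - l) < e.

Record is_completion (K L : fieldType) (v : K -> R) (w : L -> R)
    (f : {rmorphism K -> L}) : Prop := {
  completion_abs : nonarchimedean_abs w;
  completion_isometry : forall x, w (f x) = v x;
  completion_dense : forall (z : L) (e : R), 0 < e ->
    exists x : K, w (z - f x) < e;
  completion_complete : forall u : nat -> L, abs_cauchy w u ->
    exists l : L, abs_cvg_to w u l
}.

(* Since K is complete in the intended use, the absolute value w extending v  *)
(* is the only one on L.                                                      *)
Record is_normed_algebraic_closure (K L : fieldType) (v : K -> R) (w : L -> R)
    (f : {rmorphism K -> L}) : Prop := {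
  algclosure_algebraic : forall z : L, algebraicOver f z;
  algclosure_closed : GRing.closed_field_axiom L;
  algclosure_abs : nonarchimedean_abs w;
  algclosure_isometry : forall x, w (f x) = v x
}.

Definition padic_abs (p : nat) (q : rat) : R :=
  if q == 0 then 0
  else p%:R ^+ logn p `|denq q|%N / p%:R ^+ logn p `|numq q|%N.

End AbsoluteValue.

(* C_p, presented by the tower Q -> Q_p -> algebraic closure of Q_p -> C_p.   *)
(* For p prime these data are unique up to isometric isomorphism, so that     *)
(* quantifying over them amounts to working in C_p.                           *)
Record padicComplex (R : realType) (p : nat) := PadicComplex {
  padicComplex_sort :> fieldType;
  padicComplex_abs : padicComplex_sort -> R;
  padic_sort : fieldType;
  padic_sort_abs : padic_sort -> R;
  padic_of_rat : {rmorphism rat -> padic_sort};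
  padic_completion : is_completion (@padic_abs R p) padic_sort_abs padic_of_rat;
  padicbar_sort : fieldType;
  padicbar_abs : padicbar_sort -> R;
  padicbar_of_padic : {rmorphism padic_sort -> padicbar_sort};
  padicbar_closure :
    is_normed_algebraic_closure padic_sort_abs padicbar_abs padicbar_of_padic;
  padicComplex_of_padicbar : {rmorphism padicbar_sort -> padicComplex_sort};
  padicComplex_completion :
    is_completion padicbar_abs padicComplex_abs padicComplex_of_padicbar
}.

(* A formal power series \sum_n a_n t^n is the sequence a of its              *)
(* coefficients.                                                              *)
Section PowerSeries.
Variable K : fieldType.
Implicit Types a b : nat -> K.

Definition fps_const (c : K) : nat -> K := fun n => if n == 0%N then c else 0.

Definition fps_add a b : nat -> K := fun n => a n + b n.

Definition fps_mul a b : nat -> K :=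
  fun n => \sum_(i < n.+1) a i * b (n - i)%N.

Definition fps_exp a (r : nat) : nat -> K :=
  iter r (fps_mul a) (fps_const 1).

(* First n coefficients of the inverse b of a, obtained by solving            *)
(* a_0 b_k + \sum_(i < k) b_i a_(k - i) = [k = 0] for b_k.                    *)
Fixpoint fps_inv_coefs a (n : nat) : seq K :=
  if n is k.+1 then
    let s := fps_inv_coefs a k in
    rcons s ((a 0%N)^-1 * ((k == 0%N)%:R - \sum_(i < k) s`_i * a (k - i)%N))
  else [::].

Definition fps_inv a : nat -> K := fun n => (fps_inv_coefs a n.+1)`_n.

Definition fps_div a b : nat -> K := fps_mul a (fps_inv b).

Lemma size_fps_inv_coefs a n : size (fps_inv_coefs a n) = n.
Proof. by elim: n => //= n IHn; rewrite size_rcons IHn. Qed.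

Lemma nth_fps_inv_coefs a n i :
  (i < n)%N -> (fps_inv_coefs a n)`_i = fps_inv a i.
Proof.
elim: n => // n IHn; rewrite ltnS leq_eqVlt => /orP[/eqP -> //|lt_in].
by rewrite /= nth_rcons size_fps_inv_coefs lt_in IHn.
Qed.

Lemma fps_mulVr a : a 0%N != 0 -> fps_mul (fps_inv a) a =1 fps_const 1.
Proof.
move=> a0 n; rewrite /fps_mul big_ord_recr /= subnn {2}/fps_inv /=.
rewrite nth_rcons size_fps_inv_coefs ltnn eqxx mulrAC mulVf // mul1r.
rewrite [X in _ - X](_ : _ = \sum_(i < n) fps_inv a i * a (n - i)%N).
  by rewrite addrC subrK /fps_const; case: eqP.
by apply: eq_bigr => i _; rewrite nth_fps_inv_coefs.
Qed.

End PowerSeries.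

Section DegenerateEuler.
Variable K : fieldType.

Definition degenerate_falling (lambda x : K) (n : nat) : K :=
  \prod_(i < n) (x - i%:R * lambda).

(* (1 + lambda t)^(x / lambda) *)
Definition degenerate_exp (lambda x : K) : nat -> K :=
  fun n => degenerate_falling lambda x n / n`!%:R.

(* (2 / ((1 + lambda t)^(1 / lambda) + 1))^r (1 + lambda t)^(x / lambda) *)
Definition degenerate_euler_gen (r : nat) (lambda x : K) : nat -> K :=
  fps_mul
    (fps_exp (fps_div (fps_const 2)
                      (fps_add (degenerate_exp lambda 1) (fps_const 1))) r)
    (degenerate_exp lambda x).

(* E_n^(r)(x | lambda) *)
Definition degenerate_euler (r n : nat) (lambda x : K) : K :=
  n`!%:R * degenerate_euler_gen r lambda x n.

End DegenerateEuler.

(* Main.v *)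
Require Import Defs.
From HB Require Import structures.
From mathcomp Require Import all_boot all_order all_algebra.
From mathcomp Require Import reals.
From mathcomp Require Import boolp ring.

Set Implicit Arguments.
Unset Strict Implicit.
Unset Printing Implicit Defensive.

Import Order.TTheory GRing.Theory Num.Theory.
Local Open Scope ring_scope.

(* With E_a = (1 + lambda t)^(a / lambda) and G_w = 2 / (E_w + 1), replacing t *)
(* by w t turns the parameter lambda / w into lambda, so the left-hand side is *)
(* n! times the n-th coefficient of                                           *)
(*   G_w2^(m-1) G_w1^m E_(w1 w2 x) E_(w1 w2 y) \sum_(i < w1) (- E_w2)^i.      *)
(* As w1 is odd, twice the geometric sum is G_w2 (E_(w1 w2) + 1), which makes *)
(* the product symmetric in w1 and w2.                                        *)

(** Binomial convolutions are products of exponential generating functions, so each side is [n!]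
    times one coefficient of a single product of power series ([binomial_sum_dilate]). On the left
    that product has m factors G_w1 but only m-1 factors G_w2. The alternating sum over i, a
    geometric sum by the exponent law [degenerate_expD], supplies the missing G_w2 and a factor
    symmetric in w1 and w2 ([sum_signed_degenerate_exp]). [degenerate_euler_sumE] records the
    symmetric closed form, and the theorem compares two instances of it. Characteristic 0
    ([pchar_padicComplex]) makes factorials and 2 invertible. *)

(* A copy of nat -> K that does not inherit the pointwise product. *)
Definition fps (K : fieldType) := nat -> K.

HB.instance Definition _ (K : fieldType) := gen_eqMixin (fps K).
HB.instance Definition _ (K : fieldType) := gen_choiceMixin (fps K).

(** * The commutative ring of formal power series *)

Section FpsRing.
Variable K : fieldType.
Implicit Types a b : fps K.

Let opp a : fps K := fun n => - a n.

Fact fps_addA : associative (@fps_add K : fps K -> fps K -> fps K).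
Proof. by move=> a b c; apply/funext => n; rewrite /fps_add addrA. Qed.

Fact fps_addC : commutative (@fps_add K : fps K -> fps K -> fps K).
Proof. by move=> a b; apply/funext => n; rewrite /fps_add addrC. Qed.

Fact fps_add0 : left_id (fun=> 0 : K) (@fps_add K : fps K -> fps K -> fps K).
Proof. by move=> a; apply/funext => n; rewrite /fps_add add0r. Qed.

Fact fps_addN :
  left_inverse (fun=> 0 : K) opp (@fps_add K : fps K -> fps K -> fps K).
Proof. by move=> a; apply/funext => n; rewrite /fps_add addNr. Qed.

HB.instance Definition _ :=
  GRing.isZmodule.Build (fps K) fps_addA fps_addC fps_add0 fps_addN.

(** Coefficient [k] of a product involves only indices at most [k], so truncation is harmless;
    commutativity and associativity are then inherited from polynomials. *)
Lemma coef_fps_mul_poly a b (N k : nat) : (k < N)%N ->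
  fps_mul a b k = (\poly_(i < N) a i * \poly_(i < N) b i)`_k.
Proof.
move=> kN; rewrite coefM; apply: eq_bigr => i _; rewrite !coef_poly.
by rewrite (leq_ltn_trans _ kN) ?(leq_ltn_trans _ kN) ?leq_subr// -ltnS.
Qed.

Fact fps_mulC : commutative (@fps_mul K : fps K -> fps K -> fps K).
Proof.
by move=> a b; apply/funext => n; rewrite !(coef_fps_mul_poly _ _ (ltnSn n)) mulrC.
Qed.

Fact fps_mulA : associative (@fps_mul K : fps K -> fps K -> fps K).
Proof.
move=> a b c; apply/funext => n.
transitivity ((\poly_(i < n.+1) a i * \poly_(i < n.+1) b i
   * \poly_(i < n.+1) c i)`_n); [rewrite -mulrA|]; rewrite coefM.
  apply: eq_bigr => i _.
  by rewrite coef_poly ltn_ord -coef_fps_mul_poly// ltnS leq_subr.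
apply: eq_bigr => i _.
by rewrite coef_poly ltnS leq_subr -coef_fps_mul_poly.
Qed.

Fact fps_mul1 :
  left_id (fps_const 1 : fps K) (@fps_mul K : fps K -> fps K -> fps K).
Proof.
move=> a; apply/funext => n; rewrite /fps_mul big_ord_recl /fps_const /= mul1r.
by rewrite subn0 big1 ?addr0// => i _; rewrite mul0r.
Qed.

Fact fps_mulDl :
  left_distributive (@fps_mul K : fps K -> fps K -> fps K) +%R.
Proof.
move=> a b c; apply/funext => n; rewrite /fps_mul -[RHS]big_split /=.
by apply: eq_bigr => i _; rewrite -mulrDl.
Qed.

Fact fps_one_neq0 : fps_const 1 != 0 :> fps K.
Proof.
apply/eqP => /(congr1 (fun a : fps K => a 0%N)) /eqP.
by rewrite [_ == _](oner_eq0 K).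
Qed.

HB.instance Definition _ := GRing.Zmodule_isComNzRing.Build (fps K)
  fps_mulA fps_mulC fps_mul1 fps_mulDl fps_one_neq0.

Lemma coef_fpsM a b n : (a * b) n = \sum_(i < n.+1) a i * b (n - i)%N.
Proof. by []. Qed.

Lemma coef_fpsMn a k n : (a *+ k) n = a n *+ k.
Proof.
by elim: k => [|k IHk]; rewrite ?mulr0n// !mulrSr -IHk.
Qed.

Lemma coef_fps_sum (I : Type) (r : seq I) (F : I -> fps K) n :
  (\sum_(i <- r) F i) n = \sum_(i <- r) F i n.
Proof. exact: (big_morph (fun a : fps K => a n)). Qed.

Lemma coef_fps_signM a i n : ((-1) ^+ i * a) n = (-1) ^+ i * a n.
Proof. by rewrite -signr_odd -[in RHS]signr_odd !mulr_sign; case: odd. Qed.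

Lemma fps_expE a r : fps_exp a r = a ^+ r.
Proof. by elim: r => // r IHr; rewrite exprS -IHr. Qed.

Lemma fps_const2 : fps_const 2 = 2%:R :> fps K.
Proof.
by apply/funext => -[|n]; rewrite coef_fpsMn // [RHS](_ : _ = 0 *+ 2) ?mul0rn.
Qed.

Lemma fps_divK a b : b 0%N != 0 -> (fps_div a b : fps K) * b = a.
Proof.
move=> b0; rewrite /fps_div -[fps_mul _ _]/(a * (fps_inv b : fps K)) -mulrA.
have -> : (fps_inv b : fps K) * b = 1 by apply/funext/fps_mulVr.
by rewrite mulr1.
Qed.

(* The substitution of c t for t. *)
Definition fps_dilate (c : K) a : fps K := fun n => c ^+ n * a n.

Fact fps_dilate_is_zmod_morphism c : zmod_morphism (fps_dilate c).
Proof. by move=> a b; apply/funext => n; rewrite [LHS]mulrBr. Qed.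

Fact fps_dilate_is_monoid_morphism c : monoid_morphism (fps_dilate c).
Proof.
split=> [|a b]; apply/funext => n.
  by case: n => [|n]; [exact: mul1r | exact: mulr0].
rewrite coef_fpsM /fps_dilate coef_fpsM mulr_sumr; apply: eq_bigr => i _.
by rewrite mulrACA -exprD subnKC// -ltnS.
Qed.

HB.instance Definition _ c := GRing.isZmodMorphism.Build (fps K) (fps K)
  (fps_dilate c) (fps_dilate_is_zmod_morphism c).
HB.instance Definition _ c := GRing.isMonoidMorphism.Build (fps K) (fps K)
  (fps_dilate c) (fps_dilate_is_monoid_morphism c).

End FpsRing.

(** Geometric sum of ratio [- q], where [(- q) ^+ k = - q ^+ k] by parity. *)
Lemma sum_signed_powers_odd (A : comNzRingType) (q : A) (k : nat) : odd k ->
  (\sum_(i < k) (-1) ^+ i * q ^+ i) * (q + 1) = q ^+ k + 1.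
Proof.
move=> k_odd; have := subrX1 (- q) k.
rewrite exprNn -signr_odd k_odd expr1 mulN1r -!opprD mulNr => /oppr_inj ->.
by rewrite mulrC; under [in RHS]eq_bigr do rewrite exprNn.
Qed.

(** * Degenerate exponentials and Euler generating functions in characteristic 0 *)

Section DegenerateEulerTheory.
Variable K : fieldType.
Hypothesis pchar0 : [pchar K] =i pred0.
Implicit Types (lambda x y : K).

Local Notation E lambda x := (degenerate_exp lambda x : fps K).

Let natr_neq0 n : (n%:R != 0 :> K) = (n != 0%N).
Proof. by rewrite ((pcharf0P _).1 pchar0). Qed.

Let fact_neq0 n : n`!%:R != 0 :> K.
Proof. by rewrite natr_neq0 -lt0n fact_gt0. Qed.

Lemma degenerate_exp0 lambda x : degenerate_exp lambda x 0 = 1.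
Proof. by rewrite /degenerate_exp /degenerate_falling big_ord0 divr1. Qed.

(** Coefficient form of the differential equation (1 + lambda t) E' = x E. *)
Lemma degenerate_expS lambda x n :
  n.+1%:R * degenerate_exp lambda x n.+1
  = (x - n%:R * lambda) * degenerate_exp lambda x n.
Proof.
rewrite /degenerate_exp /degenerate_falling big_ord_recr /= factS natrM.
by field; rewrite fact_neq0 -mulrS natr_neq0.
Qed.

(** A Vandermonde identity: the product satisfies the recurrence of [degenerate_expS] for [x + y],
    by the Leibniz rule. *)
Lemma degenerate_expD lambda x y :
  E lambda (x + y) = E lambda x * E lambda y.
Proof.
apply/funext; elim=> [|n IHn].
  by rewrite coef_fpsM big_ord1 !degenerate_exp0 mulr1.
apply: (@mulfI _ n.+1%:R); first by rewrite natr_neq0.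
rewrite degenerate_expS {}IHn !coef_fpsM !mulr_sumr.
set e := degenerate_exp lambda.
(* Leibniz rule: the factor n+1 splits as i + (n+1-i). *)
transitivity (\sum_(i < n.+2) i%:R * e x i * e y (n.+1 - i)%N
   + \sum_(i < n.+2) e x i * ((n.+1 - i)%N%:R * e y (n.+1 - i)%N)); last first.
  rewrite -big_split; apply: eq_bigr => i _ /=.
  by rewrite natrB -1?ltnS//; ring.
(* The terms i = 0 of the first sum and i = n+1 of the second vanish; what remains is indexed by the
   same range, and the recurrence applies termwise. *)
rewrite [X in _ = X + _]big_ord_recl [X in _ = _ + X]big_ord_recr /= subnn.
rewrite !mul0r mulr0 add0r addr0.
rewrite -big_split; apply: eq_bigr => i _ /=.
have le_in : (i <= n)%N by rewrite -ltnS.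
rewrite /bump /= add1n subSS subSn// !degenerate_expS natrB// -/e; ring.
Qed.

Lemma degenerate_exp_muln lambda x n : E lambda (n%:R * x) = E lambda x ^+ n.
Proof.
elim: n => [|n IHn]; last by rewrite mulrSr mulrDl mul1r degenerate_expD IHn exprSr.
apply/funext => -[|n]; first by rewrite degenerate_exp0.
rewrite /degenerate_exp /degenerate_falling mul0r big_ord_recl /= mul0r subr0.
by rewrite mul0r mul0r.
Qed.

Lemma fps_dilate_degenerate_exp (w lambda x : K) : w != 0 ->
  fps_dilate w (E (lambda / w) x) = E lambda (w * x).
Proof.
move=> w0; apply/funext => n.
rewrite /fps_dilate /degenerate_exp /degenerate_falling mulrA; congr (_ / _).
rewrite -[n in w ^+ n]card_ord -prodr_const -big_split; apply: eq_bigr => i _ /=.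
by field.
Qed.

Definition degenerate_euler_base lambda : fps K :=
  fps_div (fps_const 2) (fps_add (degenerate_exp lambda 1) (fps_const 1)).

Lemma degenerate_euler_baseK lambda :
  degenerate_euler_base lambda * (E lambda 1 + 1) = 2%:R.
Proof.
rewrite -fps_const2; apply: fps_divK.
by rewrite /fps_add degenerate_exp0 (natr_neq0 2).
Qed.

Lemma degenerate_euler_genE r lambda x :
  degenerate_euler_gen r lambda x = degenerate_euler_base lambda ^+ r * E lambda x.
Proof. by rewrite -fps_expE. Qed.

(** This is G_w = 2 / ((1 + lambda t)^(w / lambda) + 1), as [dilated_euler_baseK] shows for positive
    [w]. *)
Definition dilated_euler_base lambda (w : nat) : fps K :=
  fps_dilate w%:R (degenerate_euler_base (lambda / w%:R)).

Lemma dilated_euler_baseK lambda w : (0 < w)%N ->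
  dilated_euler_base lambda w * (E lambda w%:R + 1) = 2%:R.
Proof.
rewrite lt0n -natr_neq0 => w0; rewrite -[X in degenerate_exp _ X]mulr1.
rewrite -fps_dilate_degenerate_exp// -(rmorph1 (fps_dilate w%:R)) -rmorphD.
by rewrite -rmorphM degenerate_euler_baseK rmorph_nat rmorph1.
Qed.

Lemma fps_dilate_euler_gen r lambda x w : (0 < w)%N ->
  fps_dilate w%:R (degenerate_euler_gen r (lambda / w%:R) x)
  = dilated_euler_base lambda w ^+ r * E lambda (w%:R * x).
Proof.
rewrite lt0n -natr_neq0 => w0.
by rewrite degenerate_euler_genE rmorphM rmorphXn /= fps_dilate_degenerate_exp.
Qed.

(** Multiply the geometric sum identity for q = E_w2 by G_w2, and use G_w2 (E_w2 + 1) = 2. *)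
Lemma sum_signed_degenerate_exp lambda (w1 w2 : nat) : odd w1 -> (0 < w2)%N ->
  (\sum_(i < w1) (-1) ^+ i * E lambda (w2%:R * i%:R)) *+ 2
  = dilated_euler_base lambda w2 * (E lambda (w1%:R * w2%:R) + 1).
Proof.
move=> w1_odd w2_gt0; rewrite degenerate_exp_muln -sum_signed_powers_odd//.
rewrite mulrCA dilated_euler_baseK// mulr_natr; congr (_ *+ 2).
by apply: eq_bigr => i _; rewrite [_ * i%:R]mulrC degenerate_exp_muln.
Qed.

Lemma binomial_sum_dilate (c d : K) (a b : fps K) n :
  \sum_(k < n.+1) 'C(n, k)%:R * c ^+ k * d ^+ (n - k)%N
     * ((n - k)%N`!%:R * b (n - k)%N) * (k`!%:R * a k)
  = n`!%:R * (fps_dilate c a * fps_dilate d b) n.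
Proof.
rewrite coef_fpsM mulr_sumr; apply: eq_bigr => k _.
by rewrite -(bin_fact (n := n) (m := k)) -1?ltnS// !natrM /fps_dilate; ring.
Qed.

(** Here [m] stands for the m-1 of the theorem. Doubling lets the alternating sum be replaced by
    G_w2 (E_(w1 w2) + 1), which raises the exponent of G_w2 to [m.+1], that of G_w1. *)
Lemma degenerate_euler_sumE lambda x y (w1 w2 n m : nat) :
  odd w1 -> (0 < w2)%N ->
  (\sum_(k < n.+1)
     'C(n, k)%:R * w1%:R ^+ k * w2%:R ^+ (n - k)%N
     * degenerate_euler m (n - k)%N (lambda / w2%:R) (w1%:R * y)
     * (\sum_(i < w1)
          (-1) ^+ i
          * degenerate_euler m.+1 k (lambda / w1%:R)
              (w2%:R * x + w2%:R / w1%:R * i%:R))) *+ 2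
  = n`!%:R * (dilated_euler_base lambda w1 ^+ m.+1
      * dilated_euler_base lambda w2 ^+ m.+1
      * E lambda (w1%:R * w2%:R * x) * E lambda (w1%:R * w2%:R * y)
      * (E lambda (w1%:R * w2%:R) + 1)) n.
Proof.
move=> w1_odd w2_gt0; have w1_gt0 := odd_gt0 w1_odd.
pose a : fps K := \sum_(i < w1) (-1) ^+ i * (degenerate_euler_gen m.+1
  (lambda / w1%:R) (w2%:R * x + w2%:R / w1%:R * i%:R) : fps K).
pose b : fps K := degenerate_euler_gen m (lambda / w2%:R) (w1%:R * y).
rewrite [X in X *+ 2](_ : _ = n`!%:R * (fps_dilate w1%:R a * fps_dilate w2%:R b) n).
  rewrite -mulrnAr -coef_fpsMn; congr (_ * _ n).
  have -> : fps_dilate w1%:R a = dilated_euler_base lambda w1 ^+ m.+1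
      * E lambda (w1%:R * w2%:R * x)
      * \sum_(i < w1) (-1) ^+ i * E lambda (w2%:R * i%:R).
    rewrite rmorph_sum mulr_sumr; apply: eq_bigr => i _ /=.
    rewrite rmorphM rmorph_sign /= fps_dilate_euler_gen//.
    have -> : w1%:R * (w2%:R * x + w2%:R / w1%:R * i%:R)
        = w1%:R * w2%:R * x + w2%:R * i%:R :> K.
      by field; rewrite natr_neq0 -lt0n.
    by rewrite degenerate_expD; ring.
  rewrite fps_dilate_euler_gen// mulrAC -mulrnAr sum_signed_degenerate_exp//.
  have rearrange (A B C X Y Z : fps K) :
    A * X * (B * Y) * (C * Z) = A * (C * B) * X * Y * Z by ring.
  by rewrite [w2%:R * _]mulrA [w2%:R * w1%:R]mulrC rearrange -exprS.
rewrite -binomial_sum_dilate; apply: eq_bigr => k _; congr (_ * _).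
rewrite /a coef_fps_sum mulr_sumr; apply: eq_bigr => i _.
by rewrite coef_fps_signM mulrCA.
Qed.

End DegenerateEulerTheory.

(** Field embeddings preserve the characteristic, so the tower transports it from [rat]. *)
Lemma pchar_padicComplex (R : realType) (p : nat) (Cp : padicComplex R p) :
  [pchar Cp] =i pred0.
Proof.
move=> q; rewrite (fmorph_pchar (padicComplex_of_padicbar Cp)).
rewrite (fmorph_pchar (padicbar_of_padic Cp)) (fmorph_pchar (padic_of_rat Cp)).
exact: pchar_num.
Qed.

Theorem theorem4 (R : realType) (p : nat) (p_prime : prime p) (p_odd : odd p)
    (Cp : padicComplex R p) (lambda x y : Cp) (lambda_neq0 : lambda != 0)
    (w1 w2 : nat) (w1_gt0 : (0 < w1)%N) (w2_gt0 : (0 < w2)%N)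
    (w1_odd : w1 = 1 %[mod 2]) (w2_odd : w2 = 1 %[mod 2])
    (n m : nat) (m_ge1 : (1 <= m)%N) :
  \sum_(k < n.+1)
     'C(n, k)%:R * w1%:R ^+ k * w2%:R ^+ (n - k)%N
     * degenerate_euler (m - 1)%N (n - k)%N (lambda / w2%:R) (w1%:R * y)
     * (\sum_(i < w1)
          (-1) ^+ i
          * degenerate_euler m k (lambda / w1%:R)
              (w2%:R * x + w2%:R / w1%:R * i%:R))
  = \sum_(k < n.+1)
     'C(n, k)%:R * w2%:R ^+ k * w1%:R ^+ (n - k)%N
     * degenerate_euler (m - 1)%N (n - k)%N (lambda / w1%:R) (w2%:R * y)
     * (\sum_(i < w2)
          (-1) ^+ i
          * degenerate_euler m k (lambda / w2%:R)
              (w1%:R * x + w1%:R / w2%:R * i%:R)).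
Proof.
have odd_of w : w = 1 %[mod 2] -> odd w by rewrite !modn2 => /eqP; case: odd.
case: m m_ge1 => // m _; rewrite subn1 /=.
have pchar0 := pchar_padicComplex Cp.
have two_neq0 : 2%:R != 0 :> Cp by rewrite ((pcharf0P _).1 pchar0).
(* Both sides are doubled to match the closed form, whose symmetry then ends the proof. *)
apply: (mulIf two_neq0); rewrite !mulr_natr.
rewrite !degenerate_euler_sumE ?odd_of//.
by rewrite [w2%:R * w1%:R]mulrC [_ ^+ _ * _ ^+ _]mulrC.
Qed.
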